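(* Let $\{x_t\}_{t\in[0,1]}\in\mathscr H$ with covariance $C(s,t)=\tilde C(s-t)$, and let $\{y_t\}_{t\in[0,1]}\in\mathscr H_0$ be the process it generates, with covariance function $R(s,t)$. Let $0<\alpha\le1$. Then $\tilde C\in C^{0,\alpha}([0,1])$ implies $R\in C^{0,\alpha}([0,1]\times[0,1])$, and $R\in C^{0,\alpha}([0,1]\times[0,1])$ implies that, for every $\beta<\alpha/2$, suitable modifications $\{\tilde y_t\}$ of $y$ and $\{\tilde x_t\}$ of $x$ have almost all trajectories in $C^{0,\beta}([0,1])$.
   Context: $\mathscr H$ is the set of real zero-mean Gaussian processes on $[0,1]$ with covariance $\tilde C(s-t)$ for a continuous function $\tilde C$ and $x_0=x_1$ a.s. The process generated by $x\in\mathscr H$ is the zero-mean Gaussian process $y$ whose finite-dimensional laws equal those of $x$ conditioned on $x_0=0$; its covariance is $R(s,t)=C(s,t)-C(s,0)C(0,t)/C(0,0)$; $\mathscr H_0$ is the set of such $y$. $C^{0,\alpha}$ denotes the Hölder space with exponent $\alpha$. *)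

(* Defs.v *)
From HB Require Import structures.
From mathcomp Require Import all_boot all_order all_algebra.
From mathcomp Require Import all_classical all_reals all_analysis.
Unset Strict Implicit. Unset Printing Implicit Defensive.
Import Order.TTheory GRing.Theory Num.Theory.
Import numFieldNormedType.Exports.
Local Open Scope classical_set_scope.
Local Open Scope ring_scope.

Definition I01 {R : realType} : set R := `[0, 1]%classic.

Definition hoelder_on {R : realType} (A : set R) (f : R -> R) (a : R) : Prop :=
  exists K : R, forall s t, A s -> A t -> `|f s - f t| <= K * (`|s - t| `^ a).

Definition hoelder_on2 {R : realType} (A : set R) (f : R -> R -> R) (a : R) :
  Prop :=
  exists K : R, forall s t s' t', A s -> A t -> A s' -> A t' ->
    `|f s t - f s' t'| <= K * (Num.max `|s - s'| `|t - t'| `^ a).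

Definition centered_gaussian_rv {d} {T : measurableType d} {R : realType}
  (P : probability T R) (Z : T -> R) (v : R) : Prop :=
  0 <= v /\
  forall A : set R, measurable A ->
    P (Z @^-1` A) =
      (if v == 0 then @dirac _ R 0 R A else normal_prob 0 (Num.sqrt v) A).

Definition centered_gaussian_process {d} {T : measurableType d}
  {R : realType} (P : probability T R) (x : R -> {RV P >-> R}) : Prop :=
  forall (n : nat) (ts : 'I_n -> R) (c : 'I_n -> R),
    (forall i, I01 (ts i)) ->
    exists v : R,
      centered_gaussian_rv P (fun w => \sum_(i < n) c i * x (ts i) w) v.

Definition in_H {d} {T : measurableType d} {R : realType}
  (P : probability T R) (x : R -> {RV P >-> R}) (Ct : R -> R) : Prop :=
  [/\ {within `[-1, 1]%classic, continuous Ct},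
      centered_gaussian_process P x,
      (forall s t, I01 s -> I01 t -> covariance P (x s) (x t) = (Ct (s - t))%:E)
    & {ae P, forall w, x 0 w = x 1 w}].

(* Covariance R(s,t) = C(s,t) - C(s,0) C(0,t) / C(0,0) of the generated
   process, with C(s,t) = Ct (s - t). *)
Definition gen_cov {R : realType} (Ct : R -> R) (s t : R) : R :=
  Ct (s - t) - Ct (s - 0) * Ct (0 - t) / Ct (0 - 0).

(* y is the process generated by x in H with covariance function Ct:
   y is a zero-mean Gaussian process (on [0,1]) whose finite-dimensional laws
   are those of x conditioned on x_0 = 0, i.e. with covariance gen_cov Ct. *)
Definition generated_by {d} {T : measurableType d} {R : realType}
  (P : probability T R) (y : R -> {RV P >-> R}) (Ct : R -> R) : Prop :=
  centered_gaussian_process P y /\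
  forall s t, I01 s -> I01 t -> covariance P (y s) (y t) = (gen_cov Ct s t)%:E.

Definition modification {d} {T : measurableType d} {R : realType}
  (P : probability T R) (x xt : R -> {RV P >-> R}) : Prop :=
  forall t, I01 t -> {ae P, forall w, xt t w = x t w}.

Definition ae_hoelder_paths {d} {T : measurableType d} {R : realType}
  (P : probability T R) (x : R -> {RV P >-> R}) (b : R) : Prop :=
  {ae P, forall w, hoelder_on I01 (fun t => x t w) b}.

(* Main.v *)
(** Both path regularity claims are instances of the Kolmogorov-Chentsov criterion: if
    Var (X_s - X_t) <= K |s - t|^alpha for a centered Gaussian process, then the
    moment of order 2m of X_s - X_t is at most C_m |s - t|^(m alpha), and m is
    taken so large that m (alpha - 2 beta) > 1.  For y the variance bound is
    immediate from the covariance.  For x one has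
    C(0) R(u,u) = (C(0) - C(u)) (C(0) + C(u)), R(0,0) = 0 and, by continuity of C
    at 0, C(0) + C(u) >= C(0) for small u; hence C(0) - C(u) = O(u^alpha).

    Kolmogorov-Chentsov is proved without Borel-Cantelli: the series of the
    suitably weighted moments of the increments between neighbouring dyadic
    points of level n converges, so almost surely these increments are at most
    M 2^(-n beta) with a random M, and chaining makes the values of the process
    at the dyadic approximations of t converge to a Hoelder function of t. *)
Require Import Defs.
From HB Require Import structures.
From mathcomp Require Import all_boot all_order all_algebra.
From mathcomp Require Import all_classical all_reals all_analysis.
From mathcomp Require Import measurable_realfun zify ring lra.
Import Order.TTheory GRing.Theory Num.Theory.
Import numFieldNormedType.Exports.
Local Open Scope classical_set_scope.
Local Open Scope ring_scope.
Set Implicit Arguments.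
Unset Strict Implicit.

(** * Centered Gaussian variables *)

(** The law is dominated by Lebesgue measure, and its Radon-Nikodym derivative is almost everywhere
    the density because both have the same integral over every measurable set. *)
Lemma ge0_integral_normal_prob (R : realType) (m s : R) (f : _ -> \bar R) :
  measurable_fun setT f -> (forall x, 0 <= f x)%E ->
  (\int[normal_prob m s]_x f x =
   \int[lebesgue_measure]_x (f x * (normal_pdf m s x)%:E))%E.
Proof.
move=> mf f0; have dom := normal_prob_dominates m s.
rewrite -(Radon_Nikodym_SigmaFinite.change_of_variables dom)//.
have ig := Radon_Nikodym_SigmaFinite.f_integrable dom.
apply: ae_eq_integral => //.
- apply: emeasurable_funM => //; exact: measurable_int ig.
- apply: emeasurable_funM => //; apply/measurable_EFinP.
  exact: measurable_normal_pdf.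
- apply: ae_eqe_mul2l; apply: integral_ae_eq => //.
  + by apply/measurable_EFinP; exact: measurable_normal_pdf.
  + by move=> E _ mE; rewrite -Radon_Nikodym_SigmaFinite.f_integral.
Qed.

(* [x^2k <= k! (4v)^k exp(x^2/(4v))], and the exponential turns the density of
   N(0,v) into [sqrt 2] times that of N(0,2v). *)
Lemma normal_pdf_moment_le (R : realType) (v x : R) (m : nat) : 0 < v ->
  x ^+ (m.+1 * 2) * normal_pdf 0 (Num.sqrt v) x <=
  Num.sqrt 2 * m.+1`!%:R * (4 * v) ^+ m.+1 * normal_pdf 0 (Num.sqrt (2 * v)) x.
Proof.
move=> v0; have v20 : 0 < 2 * v by rewrite mulr_gt0.
have v40 : 0 < 4 * v by rewrite mulr_gt0.
have vn0 : v != 0 by rewrite gt_eqF.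
rewrite !normal_pdfE ?gt_eqF ?sqrtr_gt0// /normal_peak /normal_fun !subr0.
rewrite sqr_sqrtr; last exact: ltW.
rewrite sqr_sqrtr; last exact: ltW.
have -> : Num.sqrt (2 * v * pi *+ 2) = Num.sqrt 2 * Num.sqrt (v * pi *+ 2).
  by rewrite -sqrtrM//; congr Num.sqrt; ring.
set p := Num.sqrt (v * pi *+ 2).
have p0 : 0 < p by rewrite sqrtr_gt0 mulrn_wgt0// mulr_gt0// pi_gt0.
have r0 : 0 < Num.sqrt 2 :> R by rewrite sqrtr_gt0.
have y0 : 0 <= x ^+ 2 / (4 * v) by rewrite divr_ge0 ?sqr_ge0// ltW.
have hx : x ^+ (m.+1 * 2) <= m.+1`!%:R * (4 * v) ^+ m.+1 * expR (x ^+ 2 / (4 * v)).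
  rewrite mulnC exprM.
  have -> : x ^+ 2 = x ^+ 2 / (4 * v) * (4 * v) by field.
  rewrite exprMn [leRHS]mulrAC ler_pM2r ?exprn_gt0// -ler_pdivrMl ?ltr0n ?fact_gt0//.
  rewrite mulfK ?gt_eqF// mulrC; apply: le_trans (expR_ge1Dxn m y0).
  by rewrite lerDr.
have -> : - x ^+ 2 / (v *+ 2) = - (x ^+ 2 / (4 * v)) + - x ^+ 2 / (2 * v *+ 2).
  by field.
rewrite expRD expRN; set E := expR (_ / (4 * v)); set G := expR _.
have G0 : 0 < G by rewrite expR_gt0.
have E0 : 0 < E by rewrite expR_gt0.
rewrite [leLHS](_ : _ = x ^+ (m.+1 * 2) / E * (p^-1 * G)); last by ring.
rewrite [leRHS](_ : _ = m.+1`!%:R * (4 * v) ^+ m.+1 * (p^-1 * G)); last first.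
  by field; rewrite !gt_eqF.
apply: ler_wpM2r; first by rewrite mulr_ge0// ?invr_ge0 ltW.
by rewrite ler_pdivrMr.
Qed.

Section centered_gaussian.
Context d (T : measurableType d) (R : realType) (P : probability T R).
Variables (Z : {RV P >-> R}) (v : R).
Hypothesis gZ : centered_gaussian_rv P Z v.

Lemma centered_gaussian_rv_integral (f : R -> R) :
  measurable_fun setT f -> (forall x, 0 <= f x) ->
  (\int[P]_w (f (Z w))%:E)%E = if v == 0 then (f 0)%:E else
    (\int[lebesgue_measure]_x (f x * normal_pdf 0 (Num.sqrt v) x)%:E)%E.
Proof.
move=> mf f0; pose Y := measurableTypeR R.
have mZ : measurable_fun setT (Z : T -> Y) := @measurable_funPT _ _ _ _ Z.
have mfE : measurable_fun setT (fun y : Y => (f y)%:E) by exact/measurable_EFinP.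
have [_ PZ] := gZ.
transitivity (\int[pushforward P (Z : T -> Y)]_y (f y)%:E)%E.
  by rewrite (ge0_integral_pushforward mZ)// => y _; rewrite lee_fin.
case: eqP => [v0|/eqP v0].
  rewrite (eq_measure_integral (@dirac _ Y 0 R)) => [|A mA _]; last first.
    by have := PZ A mA; rewrite v0 eqxx.
  by rewrite (integral_dirac _ _ mfE)//= diracT mul1e.
transitivity (\int[normal_prob 0 (Num.sqrt v)]_x (f x)%:E)%E.
  by apply: eq_measure_integral => A mA _; have := PZ A mA; rewrite (negbTE v0).
by rewrite ge0_integral_normal_prob// => x; rewrite lee_fin.
Qed.

Lemma centered_gaussian_variance_gt0 : v != 0 -> 0 < v.
Proof. by move=> v0; rewrite lt_neqAle eq_sym v0; have [] := gZ. Qed.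

(** Integrate the pointwise comparison of densities: the density of N(0,2v) in the majorant has mass
    one. *)
Lemma centered_gaussian_rv_moment (m : nat) :
  (\int[P]_w ((Z w) ^+ (m.+1 * 2))%:E <=
   (Num.sqrt 2 * m.+1`!%:R * (4 * v) ^+ m.+1)%:E)%E.
Proof.
have ev x : 0 <= x ^+ (m.+1 * 2) :> R by rewrite mulnC exprM exprn_ge0 ?sqr_ge0.
have mX : measurable_fun setT (fun x : R => x ^+ (m.+1 * 2)) by exact: measurable_funX.
rewrite (centered_gaussian_rv_integral mX ev).
have [->|v0] := eqVneq v 0; first by rewrite expr0n mulr0 expr0n mulr0.
have vgt0 := centered_gaussian_variance_gt0 v0.
set C := _ * _ ^+ _.
have C0 : 0 <= C by rewrite mulr_ge0 ?mulr_ge0// exprn_ge0// mulr_ge0// ltW.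
have mpdf s : measurable_fun setT (EFin \o normal_pdf (0 : R) s).
  by apply/measurable_EFinP; exact: measurable_normal_pdf.
apply: (@le_trans _ _
  (\int[lebesgue_measure]_x (C%:E * (normal_pdf 0 (Num.sqrt (2 * v)) x)%:E)))%E.
  apply: ge0_le_integral => //=.
  - by move=> x _; rewrite lee_fin mulr_ge0// normal_pdf_ge0.
  - apply/measurable_EFinP; apply: measurable_funM => //.
    exact: measurable_normal_pdf.
  - by apply: measurable_funeM; exact: mpdf.
  - by move=> x _; rewrite -EFinM lee_fin; exact: normal_pdf_moment_le.
rewrite ge0_integralZl//.
- by rewrite integral_normal_pdf mule1.
- exact: mpdf.
- by move=> x _; rewrite lee_fin normal_pdf_ge0.
Qed.

(* The density is at most [1 / sqrt (2 pi v) <= 1 / (2 sqrt v)], so the interval of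
   length [sqrt v] around the mean has probability at most 1/2; then Chebyshev. *)
Lemma centered_gaussian_rv_variance_ge : (v%:E <= 8%:E * 'V_P[Z])%E.
Proof.
have [->|v0] := eqVneq v 0; first by rewrite mule_ge0 ?variance_ge0.
have vgt0 := centered_gaussian_variance_gt0 v0.
set s := Num.sqrt v; have s_gt0 : 0 < s by rewrite sqrtr_gt0.
have s0 : s != 0 by rewrite gt_eqF.
have sv : s ^+ 2 = v by rewrite sqr_sqrtr// ltW.
(* Chebyshev centres the interval at the expectation; the bound on the density is uniform, hence
   applies around any [c]. *)
set c := fine 'E_P[Z].
have h0 : 0 < s / 2 by rewrite divr_gt0.
have cheb := chebyshev Z h0.
set A : set R := `]c - s / 2, c + s / 2[%classic.
have mA : measurable A by exact: measurable_itv.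
have PA : (P (Z @^-1` A) <= (2^-1)%:E)%E.
  have [_ ->//] := gZ; rewrite (negbTE v0) -/s /normal_prob.
  apply: (@le_trans _ _
    (\int[lebesgue_measure]_(x in A) (normal_peak s)%:E))%E.
    apply: ge0_le_integral => //=.
    - by move=> x _; rewrite lee_fin normal_pdf_ge0.
    - apply/measurable_EFinP; apply: measurable_funTS.
      exact: measurable_normal_pdf.
    - by move=> x _; rewrite lee_fin normal_pdf_ub.
  rewrite integral_cst//= lebesgue_measure_itv/= lte_fin ltrD2l gtrN// -EFinD.
  rewrite -EFinM lee_fin /normal_peak.
  have -> : c + s / 2 - (c - s / 2) = s by field.
  rewrite mulrC ler_pdivrMr; last first.
    by rewrite sqrtr_gt0 pmulrn_lgt0// mulr_gt0 ?pi_gt0// exprn_gt0.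
  (* The claim amounts to 4 s^2 <= 2 pi s^2, that is, pi >= 2. *)
  have s20 : 0 <= 2 * s by rewrite mulr_ge0// ltW.
  rewrite ler_pdivlMl// -(ger0_norm s20) -sqrtr_sqr ler_wsqrtr//.
  have := pi_ge2 R; rewrite exprMn => hpi.
  by have := sqr_ge0 s; nra.
have mZA : measurable (Z @^-1` A).
  by rewrite -[X in measurable X]setTI; exact: measurable_funP.
have PC : P [set x | (s / 2 <= `|Z x - c|)%R] = (1 - P (Z @^-1` A))%E.
  rewrite -probability_setC//.
  congr (P _); apply/seteqP; split => w /=; rewrite /A /= in_itv/= -ltr_distl.
    by rewrite leNgt => /negP.
  by rewrite leNgt => /negP.
move: cheb; rewrite PC.
have PAfin : P (Z @^-1` A) \is a fin_num by exact: fin_num_measure.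
move: PA; rewrite -(fineK PAfin) lee_fin => PA.
have := variance_ge0 P Z; case: ('V_P[Z])%E => [V| |]//; last first.
  by move=> _ _; rewrite gt0_muley ?leey// lte_fin.
rewrite lee_fin => V0; rewrite -EFinD -!EFinM !lee_fin.
(* With V the variance, Chebyshev becomes (1 - P A) v <= 4 V, and P A <= 1/2 turns this into v <= 8
   V. *)
rewrite expr_div_n sv invf_div mulrAC ler_pdivlMr// => h.
have : 0 <= (2^-1 - fine (P (Z @^-1` A))) * v by rewrite mulr_ge0 ?subr_ge0// ltW.
by move: h; lra.
Qed.

End centered_gaussian.

(** * Dyadic chaining *)

(** As c r^n (1 - r) = c r^n - c r^(n+1), the intervals of radius c r^n around u n are nested: their
    left ends [b] increase, their right ends [b'] decrease, and the limit lies in all of them. *)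
Lemma cvg_geometric_increments (R : realType) (u : nat -> R) (c r : R) :
  0 < r < 1 -> (forall n, `|u n.+1 - u n| <= c * r ^+ n * (1 - r)) ->
  exists l, u @ \oo --> l /\ forall n, `|l - u n| <= c * r ^+ n.
Proof.
move=> /andP[r0 r1] hu.
have c0 : 0 <= c.
  have := le_trans (normr_ge0 _) (hu 0%N).
  by rewrite expr0 mulr1 pmulr_lge0// subr_gt0.
pose b n := u n - c * r ^+ n; pose b' n := u n + c * r ^+ n.
have cr0 n : 0 <= c * r ^+ n by rewrite mulr_ge0// exprn_ge0// ltW.
have bnd : nondecreasing_seq b.
  apply/nondecreasing_seqP => n; have := hu n; rewrite ler_norml /b exprS => /andP[h _].
  by rewrite -subr_ge0; move: h; rewrite -subr_ge0; congr (0 <= _); ring.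
have bni : nonincreasing_seq b'.
  apply/nonincreasing_seqP => n; have := hu n; rewrite ler_norml /b' exprS => /andP[_ h].
  by rewrite -subr_ge0; move: h; rewrite -subr_ge0; congr (0 <= _); ring.
have bb' n : b n <= b' n by rewrite /b /b' lerD2l ge0_cp.
have bub m n : b m <= b' n.
  have [mn|/ltnW nm] := leqP m n.
    exact: le_trans (bnd _ _ mn) (bb' n).
  exact: le_trans (bb' m) (bni _ _ nm).
have cb : cvgn b.
  apply: nondecreasing_is_cvgn => //.
  by exists (b' 0%N) => _ [n _ <-].
exists (limn b); split.
  have -> : u = b \+ geometric c r by apply/funext => n; rewrite /b /= subrK.
  rewrite -[X in _ --> X]addr0; apply: cvgD => //.
  by apply: cvg_geometric; rewrite ger0_norm// ltW.
move=> n; rewrite ler_distl; apply/andP; split.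
  exact: nondecreasing_cvgn_le.
by apply: limr_le => //; apply: nearW => m; exact: bub.
Qed.

Definition dyadic_floor (R : realType) (n : nat) (t : R) : R :=
  (Num.truncn (2 ^+ n * t))%:R / 2 ^+ n.

Section chaining.
Variables (R : realType) (F : R -> R) (M r : R).
Hypothesis r01 : 0 < r < 1.
Hypothesis F_incr : forall n k, (k < 2 ^ n)%N ->
  `|F (k.+1%:R / 2 ^+ n) - F (k%:R / 2 ^+ n)| <= M * r ^+ n.

Let M0 : 0 <= M.
Proof. by have := le_trans (normr_ge0 _) (@F_incr 0%N 0%N isT); rewrite expr0 mulr1. Qed.

Let succ_of_gap (a b : nat) : (a < b.+1)%N -> (b < a.+2)%N -> b != a -> b = a.+1.
Proof. lia. Qed.

Lemma truncn_dyadic_le n (t : R) : 0 <= t <= 1 -> (Num.truncn (2 ^+ n * t) <= 2 ^ n)%N.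
Proof.
move=> /andP[t0 t1]; rewrite -(ler_nat R) natrX.
apply: (@le_trans _ _ (2 ^+ n * t)); last by rewrite ler_piMr// exprn_ge0.
by rewrite truncn_le mulr_ge0// exprn_ge0.
Qed.

(** The integer part of 2z is twice that of z or one more, so the two floors coincide or are
    neighbours of level n + 1. *)
Lemma dyadic_floor_step n (t : R) : 0 <= t <= 1 ->
  `|F (dyadic_floor n.+1 t) - F (dyadic_floor n t)| <= M * r ^+ n.+1.
Proof.
move=> t01; have := truncn_dyadic_le n.+1 t01.
case/andP: t01 => t0 t1; rewrite /dyadic_floor.
have e0 k : 0 < 2 ^+ k :> R by rewrite exprn_gt0.
have := @truncn_itv R (2 ^+ n.+1 * t); rewrite mulr_ge0 ?(ltW (e0 _))// => /(_ isT).
have := @truncn_itv R (2 ^+ n * t); rewrite mulr_ge0 ?(ltW (e0 _))// => /(_ isT).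
set j := Num.truncn (2 ^+ n * t); set j' := Num.truncn (2 ^+ n.+1 * t).
move=> /andP[h1 h2] /andP[h3 h4] h5.
have l1 : (j * 2 < j'.+1)%N.
  rewrite -(ltr_nat R) natrM; apply: le_lt_trans h4; rewrite exprS; lra.
have l2 : (j' < j.+1 * 2)%N.
  rewrite -(ltr_nat R) natrM; apply: le_lt_trans h3 _; rewrite exprS; lra.
have ej : (j%:R / 2 ^+ n = (j * 2)%N%:R / 2 ^+ n.+1 :> R).
  by rewrite exprS natrM; field; rewrite gt_eqF.
rewrite ej; have [->|jj] := eqVneq j' (j * 2)%N.
  by rewrite subrr normr0 mulr_ge0// exprn_ge0//; case/andP: r01 => /ltW.
rewrite (succ_of_gap l1 l2 jj).
(* The index is admissible: j * 2 + 1 = j' <= 2^(n+1) makes j * 2 strictly smaller. *)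
by apply: F_incr; rewrite -(succ_of_gap l1 l2 jj).
Qed.

(** After scaling by 2^n the points are at most 1 apart, so their integer parts differ by at most
    1. *)
Lemma dyadic_floor_close n (s t : R) : 0 <= s -> s <= t -> t <= 1 ->
  t - s <= 2 ^- n ->
  `|F (dyadic_floor n t) - F (dyadic_floor n s)| <= M * r ^+ n.
Proof.
move=> s0 st t1 ts; have t0 := le_trans s0 st.
have := @truncn_dyadic_le n t; rewrite t0 t1 => /(_ isT).
rewrite /dyadic_floor.
have e0 : 0 < 2 ^+ n :> R by rewrite exprn_gt0.
have := @truncn_itv R (2 ^+ n * s); rewrite mulr_ge0 ?(ltW e0)// => /(_ isT).
have := @truncn_itv R (2 ^+ n * t); rewrite mulr_ge0 ?(ltW e0)// => /(_ isT).
set j := Num.truncn (2 ^+ n * t); set k := Num.truncn (2 ^+ n * s).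
move=> /andP[h1 h2] /andP[h3 h4] h5.
have hs : 2 ^+ n * s <= 2 ^+ n * t by rewrite ler_pM2l.
have ht : 2 ^+ n * t <= 2 ^+ n * s + 1.
  by move: ts; rewrite -(ler_pM2l e0) mulfV ?gt_eqF// mulrBr lerBlDl.
have l1 : (k < j.+1)%N by rewrite -(ltr_nat R); lra.
have l2 : (j < k.+2)%N by rewrite -(ltr_nat R) -natr1; lra.
have [->|jj] := eqVneq j k.
  by rewrite subrr normr0 mulr_ge0// exprn_ge0//; case/andP: r01 => /ltW.
have jk := succ_of_gap l1 l2 jj.
by rewrite jk; apply: F_incr; rewrite -jk.
Qed.

(** The constant is that of the geometric tail: M r^(n+1) + M r^(n+2) + ... = M r / (1 - r) *
    r^n. *)
Lemma dyadic_floor_cvg (t : R) : 0 <= t <= 1 ->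
  exists l, (F (dyadic_floor n t) @[n --> \oo] --> l) /\
    forall n, `|l - F (dyadic_floor n t)| <= M * r / (1 - r) * r ^+ n.
Proof.
move=> t01; apply: cvg_geometric_increments => // n.
apply: le_trans (dyadic_floor_step n t01) _.
rewrite le_eqVlt; apply/orP; left; apply/eqP; rewrite exprS; field.
by rewrite subr_eq0 gt_eqF//; case/andP: r01.
Qed.

End chaining.

(** Take the least n satisfying the lower bound; minimality gives the upper one, and [x <= 1] does
    so when n = 0. *)
Lemma exists_dyadic_scale (R : realType) (x : R) : 0 < x <= 1 ->
  exists n, 2 ^- n.+1 < x <= 2 ^- n.
Proof.
move=> /andP[x0 x1].
have ex : exists n, 2 ^- n.+1 < x.
  exists (Num.truncn x^-1); rewrite invf_plt ?posrE// ?exprn_gt0//.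
  apply: lt_trans (truncnS_gt _) _.
  by rewrite -natrX ltr_nat ltn_expl.
exists (ex_minn ex); case: ex_minnP => -[|n] -> min /=; first by rewrite expr0 invr1.
by rewrite leNgt; apply/negP => /min; rewrite ltnn.
Qed.

Lemma powR_lt1 (R : realType) (a x : R) : 1 < a -> x < 0 -> a `^ x < 1.
Proof.
move=> a1 x0; rewrite /powR gt_eqF; last exact: lt_trans a1.
by rewrite expR_lt1 nmulr_rlt0// ln_gt0.
Qed.

Lemma dyadic_chaining_hoelder (R : realType) (F L : R -> R) (M b : R) : 0 < b ->
  (forall n k, (k < 2 ^ n)%N ->
    `|F (k.+1%:R / 2 ^+ n) - F (k%:R / 2 ^+ n)| <= M * (2 `^ (- b)) ^+ n) ->
  (forall t, 0 <= t <= 1 -> F (dyadic_floor n t) @[n --> \oo] --> L t) ->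
  hoelder_on I01 L b.
Proof.
move=> b0 hF hL; set r := 2 `^ (- b) in hF.
have r0 : 0 < r by rewrite powR_gt0.
have r1 : r < 1 by rewrite powR_lt1 ?ltr1n// oppr_lt0.
have r01 : 0 < r < 1 by rewrite r0.
pose c := M * r / (1 - r).
have Lc t n : 0 <= t <= 1 -> `|L t - F (dyadic_floor n t)| <= c * r ^+ n.
  move=> t01; have [l [lc lb]] := dyadic_floor_cvg r01 hF t01.
  by rewrite (_ : L t = l)//; exact: cvg_unique (hL _ t01) lc.
have M0 : 0 <= M.
  by have := le_trans (normr_ge0 _) (hF 0%N 0%N isT); rewrite expr0 mulr1.
have c0 : 0 <= c by rewrite divr_ge0 ?subr_ge0 ?mulr_ge0 ?(ltW r0) ?(ltW r1).
(* [M] pays for the step between the level-n floors of s and t, [2 * c] for the two tails, and [/ r]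
   for passing from r^n to r^(n+1) = (2^-(n+1))^b, which is at most (t - s)^b. *)
exists ((M + 2 * c) / r).
suff main s t : 0 <= s -> s < t -> t <= 1 ->
    `|L t - L s| <= (M + 2 * c) / r * (t - s) `^ b.
  move=> s t; rewrite /I01 /= !in_itv/= => /andP[s0 s1] /andP[t0 t1].
  have [st|ts|->] := ltgtP s t.
  - by rewrite distrC (distrC s) (gtr0_norm (_ : 0 < t - s)) ?subr_gt0//; exact: main.
  - by rewrite (gtr0_norm (_ : 0 < s - t)) ?subr_gt0//; exact: main.
  - by rewrite !subrr normr0 mulr_ge0 ?powR_ge0// divr_ge0 ?(ltW r0)// addr_ge0// mulr_ge0.
move=> s0 st t1.
have [n /andP[n1 n2]] : exists n, 2 ^- n.+1 < t - s <= 2 ^- n.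
  by apply: exists_dyadic_scale; rewrite subr_gt0 st/=; lra.
have ht : 0 <= t <= 1 by rewrite t1 andbT; lra.
have hs : 0 <= s <= 1 by rewrite s0; lra.
have := dyadic_floor_close r01 hF s0 (ltW st) t1 n2.
have := Lc t n ht; have := Lc s n hs.
set x := F _; set y := F _ => h1 h2 h3.
have h4 : `|L t - L s| <= (M + 2 * c) * r ^+ n.
  have -> : L t - L s = (L t - y) + (y - x) - (L s - x) by ring.
  apply: le_trans (ler_normB _ _) _; have := ler_normD (L t - y) (y - x); lra.
apply: le_trans h4 _; rewrite -mulrA; apply: ler_wpM2l; first lra.
have -> : r ^+ n = r^-1 * r ^+ n.+1 by rewrite exprS; field; rewrite gt_eqF.
apply: ler_wpM2l; first by rewrite invr_ge0 ltW.
have -> : r ^+ n.+1 = (2 ^- n.+1) `^ b.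
  by rewrite /r -powR_invn// -powRrM -powR_mulrn ?powR_ge0// -powRrM; congr (_ `^ _); ring.
apply: ge0_ler_powR; rewrite ?nnegrE ?ltW//.
by rewrite subr_gt0.
Qed.

(** * The Kolmogorov-Chentsov criterion *)

Section ae_bounded.
Context d (T : measurableType d) (R : realType).
Variable mu : {measure set T -> \bar R}.

(** The series of the f n has integral at most K / (1 - q), so its sum is finite almost everywhere
    and bounds each of its nonnegative terms. *)
Lemma ae_exists_ub_geometric (f : nat -> T -> R) (K q : R) :
  (forall n, measurable_fun setT (f n)) -> (forall n w, 0 <= f n w) ->
  0 < q < 1 ->
  (forall n, (\int[mu]_w (f n w)%:E <= (K * q ^+ n)%:E)%E) ->
  {ae mu, forall w, exists M, forall n, f n w <= M}.
Proof.
move=> mf f0 /andP[q0 q1] hK.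
have mfE n : measurable_fun setT (EFin \o f n) by exact/measurable_EFinP.
pose S w := (\sum_(n <oo) (f n w)%:E)%E.
have S0 w : (0 <= S w)%E by apply: nneseries_ge0 => n _ _; rewrite lee_fin.
have mS : measurable_fun setT S.
  apply: (@ge0_emeasurable_sum _ _ _ setT (fun n w => (f n w)%:E) xpredT) => //.
    by move=> n w _ _; rewrite lee_fin.
  by move=> n _; exact: mfE.
have iS : mu.-integrable setT S.
  apply/integrableP; split=> //.
  under eq_integral do rewrite gee0_abs//.
  rewrite integral_nneseries//; last by move=> n w _; rewrite lee_fin.
  apply: (@le_lt_trans _ _ (\sum_(n <oo) (K * q ^+ n)%:E)%E).
    by apply: lee_nneseries => // n _ _; apply: integral_ge0 => w _; rewrite lee_fin.
  have K0 : 0 <= K.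
    have := hK 0%N; rewrite expr0 mulr1 -lee_fin; apply: le_trans.
    by apply: integral_ge0 => w _; rewrite lee_fin.
  apply: (@le_lt_trans _ _ (K * (1 - q)^-1)%:E); last exact: ltry.
  apply: lime_le.
    apply: is_cvg_nneseries => n _ _; rewrite lee_fin mulr_ge0// exprn_ge0// ltW//.
  apply: nearW => n; rewrite sumEFin lee_fin.
  have := @geometric_le_lim R n K q K0 q0; rewrite ger0_norm; last exact: ltW.
  by move=> /(_ q1).
have := integrable_ae measurableT iS.
apply: filterS => w /(_ I) Sfin; exists (fine (S w)) => n.
rewrite -lee_fin fineK//.
have := @nneseries_lim_ge R (fun n => (f n w)%:E) xpredT 0 n.+1.
rewrite /S => /(_ _) h.
apply: le_trans (h _); last by move=> *; rewrite lee_fin.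
rewrite big_nat_recr//= leeDr// sume_ge0// => i _; by rewrite lee_fin.
Qed.

End ae_bounded.

(** Avoids p-th roots: y <= y^p if y > 1, and otherwise M >= 0 suffices. *)
Lemma le_addr1_of_expr_le (R : realType) (y M : R) (p : nat) :
  (0 < p)%N -> 0 <= y -> y ^+ p <= M -> y <= M + 1.
Proof.
move=> p0 y0 yM; have [y1|/ltW y1] := leP y 1.
  by have := le_trans (exprn_ge0 p y0) yM; lra.
have : y <= y ^+ p by rewrite -[leLHS]expr1 ler_weXn2l.
lra.
Qed.

Lemma measurable_funRV d (T : measurableType d) (R : realType)
  (P : probability T R) (f : T -> R) : measurable_fun setT f ->
  exists Z : {RV P >-> R}, f =1 Z.
Proof.
move=> mf; pose m := isMeasurableFun.Build _ _ _ _ f mf.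
pose Z : {mfun T >-> R} := HB.pack f m.
by exists Z.
Qed.

Section kolmogorov_chentsov.
Context d (T : measurableType d) (R : realType) (P : probability T R).
Variables (X : R -> {RV P >-> R}) (p : nat) (K a b : R).
Hypotheses (p0 : (0 < p)%N) (b0 : 0 < b) (pba : 1 + p%:R * b < a).
Hypothesis X_moment : forall s t, I01 s -> I01 t ->
  (\int[P]_w (`|X s w - X t w| ^+ p)%:E <= (K * `|s - t| `^ a)%:E)%E.

Let r : R := 2 `^ (- b).
Let r_gt0 : 0 < r. Proof. exact: powR_gt0. Qed.
Let r_lt1 : r < 1. Proof. by rewrite powR_lt1 ?ltr1n// oppr_lt0. Qed.
(** Ratio of the weighted moments summed over a level: 2^n increments, each of moment of order 2^(-n
    a), divided by r^(n p). The hypothesis [pba] says exactly that q < 1. *)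
Let q : R := 2 `^ (1 + p%:R * b - a).
Let q_gt0 : 0 < q. Proof. exact: powR_gt0. Qed.
Let q_lt1 : q < 1. Proof. by rewrite powR_lt1 ?ltr1n// subr_lt0. Qed.

Let weightE n : (2 ^- n) `^ a / (r ^+ n) ^+ p = (q / 2) ^+ n.
Proof.
have -> : (2 ^- n) `^ a = (2 `^ (- a)) ^+ n.
  by rewrite -powR_invn// -powRrM -powR_mulrn ?powR_ge0// -powRrM; congr (_ `^ _); ring.
rewrite exprAC -expr_div_n; congr (_ ^+ n).
rewrite /r -powR_mulrn ?powR_ge0// -powRrM -powRN.
rewrite -[X in _ / X](powRr1 (ler0n R 2)) -powRN /q -!powRD; last 2 first.
- by rewrite pnatr_eq0 implybT.
- by rewrite pnatr_eq0 implybT.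
by congr (_ `^ _); ring.
Qed.

Let K_ge0 : 0 <= K.
Proof.
have I0 : I01 (0 : R) by rewrite /I01 /= in_itv/= lexx ler01.
have I1 : I01 (1 : R) by rewrite /I01 /= in_itv/= lexx ler01.
have := X_moment I0 I1; rewrite sub0r normrN1 powR1 mulr1 -lee_fin; apply: le_trans.
by apply: integral_ge0 => w _; rewrite lee_fin exprn_ge0.
Qed.

Let mX s t c : measurable_fun setT (fun w => (`|X s w - X t w| / c) ^+ p).
Proof.
apply: measurable_funX; apply: measurable_funM => //.
by apply: measurableT_comp => //; exact: measurable_funB.
Qed.

Let weighted_moment n s t : I01 s -> I01 t -> `|s - t| <= 2 ^- n ->
  (\int[P]_w ((`|X s w - X t w| / r ^+ n) ^+ p)%:E <= (K * (q / 2) ^+ n)%:E)%E.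
Proof.
move=> Is It st; set c := ((r ^+ n) ^+ p)^-1.
have c0 : 0 <= c by rewrite invr_ge0 !exprn_ge0// ltW.
under eq_integral do rewrite expr_div_n -/c mulrC EFinM.
rewrite ge0_integralZl//; last first.
  apply/measurable_EFinP; have := mX s t 1.
  by apply: eq_measurable_fun => w _; rewrite divr1.
apply: (@le_trans _ _ (c%:E * (K * `|s - t| `^ a)%:E)%E).
  by apply: lee_wpmul2l; rewrite ?lee_fin//; exact: X_moment.
rewrite -EFinM lee_fin -weightE -/c mulrCA; apply: ler_wpM2l => //.
rewrite mulrC; apply: ler_wpM2r => //.
apply: ge0_ler_powR; rewrite ?nnegrE//.
have : 0 <= p%:R * b by rewrite mulr_ge0// ltW.
by have := pba; lra.
Qed.

Let dyadic_I01 n k : (k <= 2 ^ n)%N -> I01 (k%:R / 2 ^+ n : R).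
Proof.
move=> kn; rewrite /I01 /= in_itv/= divr_ge0 ?exprn_ge0//=.
by rewrite ler_pdivrMr ?exprn_gt0// mul1r -natrX ler_nat.
Qed.

(** Summing over k within each level yields a single M for all increments of all levels. *)
Let ae_increments : {ae P, forall w, exists M, forall n k, (k < 2 ^ n)%N ->
  `|X (k.+1%:R / 2 ^+ n) w - X (k%:R / 2 ^+ n) w| <= M * r ^+ n}.
Proof.
pose f n w := \sum_(k < 2 ^ n)
  (`|X (k.+1%:R / 2 ^+ n) w - X (k%:R / 2 ^+ n) w| / r ^+ n) ^+ p.
have g0 n s t w : 0 <= (`|X s w - X t w| / r ^+ n) ^+ p.
  by rewrite exprn_ge0// divr_ge0// exprn_ge0// ltW.
have : {ae P, forall w, exists M, forall n, f n w <= M}.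
  apply: (@ae_exists_ub_geometric _ _ _ _ f K q).
  - by move=> n; apply: measurable_sum => k; exact: mX.
  - by move=> n w; apply: sumr_ge0 => k _; exact: g0.
  - by rewrite q_gt0.
  - move=> n; rewrite /f; under eq_integral do rewrite -sumEFin.
    rewrite ge0_integral_sum//; last 2 first.
      by move=> k; apply/measurable_EFinP; exact: mX.
      by move=> k w _; rewrite lee_fin; exact: g0.
    apply: (@le_trans _ _ (\sum_(k < 2 ^ n) (K * (q / 2) ^+ n)%:E)%E).
      apply: lee_sum => k _; apply: weighted_moment.
      + exact: dyadic_I01.
      + by apply: dyadic_I01; exact: ltnW.
      + by rewrite -mulrBl -natrB// subSnn mul1r ger0_norm// invr_ge0 exprn_ge0.
    (* The 2^n summands turn (q / 2)^n into q^n. *)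
    rewrite sumEFin lee_fin sumr_const card_ord -[X in X <= _]mulr_natr natrX -mulrA.
    by rewrite -exprMn divfK.
apply: filterS => w [M hM]; exists (M + 1) => n k kn.
rewrite -ler_pdivrMr ?exprn_gt0//; apply: (le_addr1_of_expr_le p0).
  by rewrite divr_ge0// exprn_ge0// ltW.
apply: le_trans (hM n); rewrite /f (bigD1 (Ordinal kn))//= lerDl.
by apply: sumr_ge0 => i _; exact: g0.
Qed.

Let dyadic_floor_I01 n (t : R) : I01 t -> I01 (dyadic_floor n t).
Proof.
rewrite /I01 /= in_itv/= => t01; apply: dyadic_I01; exact: truncn_dyadic_le.
Qed.

Let dyadic_floor_dist n (t : R) : I01 t -> `|dyadic_floor n t - t| <= 2 ^- n.
Proof.
rewrite /I01 /= in_itv/= => /andP[t0 t1]; rewrite /dyadic_floor.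
have e0 : 0 < 2 ^+ n :> R by rewrite exprn_gt0.
have := @truncn_itv R (2 ^+ n * t); rewrite mulr_ge0 ?(ltW e0)// => /(_ isT).
set j := Num.truncn _; have -> : j.+1%:R = j%:R + 1 :> R by rewrite natr1.
move=> /andP[h1 h2].
have h3 : j%:R / 2 ^+ n <= t by rewrite ler_pdivrMr// mulrC.
have h4 : t <= j%:R / 2 ^+ n + 2 ^- n.
  by rewrite -[X in _ + X]mul1r -mulrDl ler_pdivlMr// mulrC ltW.
have h5 : 0 < 2 ^- n :> R by rewrite invr_gt0.
by rewrite ler_norml; lra.
Qed.

(** Identifies the limit of the dyadic values with X t. Only one increment per level occurs, so the
    ratio is q / 2; the null set depends on t, which is why the result is a modification. *)
Let dyadic_floor_ae_cvg t : I01 t ->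
  {ae P, forall w, X (dyadic_floor n t) w @[n --> \oo] --> X t w}.
Proof.
move=> It.
pose f n w := (`|X (dyadic_floor n t) w - X t w| / r ^+ n) ^+ p.
have : {ae P, forall w, exists M, forall n, f n w <= M}.
  apply: (@ae_exists_ub_geometric _ _ _ _ f K (q / 2)).
  - by move=> n; exact: mX.
  - by move=> n w; rewrite exprn_ge0// divr_ge0// exprn_ge0// ltW.
  - by have := q_lt1; have := q_gt0; lra.
  - move=> n; apply: weighted_moment => //; first exact: dyadic_floor_I01.
    exact: dyadic_floor_dist.
apply: filterS => w [M hM].
have hM1 n : `|X (dyadic_floor n t) w - X t w| <= (M + 1) * r ^+ n.
  rewrite -ler_pdivrMr ?exprn_gt0//; apply: (le_addr1_of_expr_le p0) (hM n).
  by rewrite divr_ge0// exprn_ge0// ltW.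
apply/subr_cvg0; apply/norm_cvg0P.
have cg : geometric (M + 1) r n @[n --> \oo] --> 0.
  by apply: cvg_geometric; rewrite ger0_norm// ltW.
apply: (squeeze_cvgr _ (cvg_cst 0) cg); apply: nearW => n.
by rewrite normr_ge0/=; exact: hM1.
Qed.

Lemma kolmogorov_chentsov : exists Xt : R -> {RV P >-> R},
  modification P X Xt /\ ae_hoelder_paths P Xt b.
Proof.
(* This null set does not depend on t: off [N] the whole path is controlled at once. *)
have [N [mN PN0 subN]] := ae_increments.
have r01 : 0 < r < 1 by rewrite r_gt0.
have goodN w : ~ N w -> exists M, forall n k, (k < 2 ^ n)%N ->
    `|X (k.+1%:R / 2 ^+ n) w - X (k%:R / 2 ^+ n) w| <= M * r ^+ n.
  by move=> Nw; apply: contrapT => h; apply: Nw; exact: subN.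
have key t : exists Z : {RV P >-> R}, I01 t -> forall w, ~ N w ->
    X (dyadic_floor n t) w @[n --> \oo] --> Z w.
  (* Outside [0,1] any random variable serves as a default. *)
  have [It|nIt] := pselect (I01 t); last by exists (X t).
  (* [N] is a measurable null set containing the bad event, and cutting off on it
     keeps the everywhere defined pointwise limit measurable. *)
  pose h n w := X (dyadic_floor n t) w * \1_(~` N) w.
  have hc w : exists l : R, h n w @[n --> \oo] --> l.
    have [Nw|Nw] := pselect (N w).
      exists 0; rewrite (_ : h ^~ w = fun=> 0); first exact: cvg_cst.
      by apply/funext => n; rewrite /h indicE memNset ?mulr0//= => /(_ Nw).
    have [M hM] := goodN w Nw.
    have t01 : 0 <= t <= 1 by move: It; rewrite /I01 /= in_itv.
    have [l [hl _]] := @dyadic_floor_cvg _ (fun s => X s w) M r r01 hM t t01.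
    exists l; rewrite (_ : h ^~ w = fun n => X (dyadic_floor n t) w)//.
    by apply/funext => n; rewrite /h indicE mem_set ?mulr1.
  have [g hg] := choice hc.
  have mg : measurable_fun setT g.
    apply: (@measurable_fun_cvg _ _ _ setT h g) => [n|w _]; last exact: hg.
    apply: measurable_funM => //; apply: measurable_indic; exact: measurableC.
  have [Z gZ] := measurable_funRV P mg; exists Z => _ w Nw.
  rewrite -gZ (_ : (fun n => X (dyadic_floor n t) w) = h ^~ w)//.
  by apply/funext => n; rewrite /h indicE mem_set ?mulr1.
have [Xt hXt] := choice key.
have aeN : {ae P, forall w, ~ N w}.
  by exists N; split => // w /contrapT.
exists Xt; split.
  move=> t It; apply: filterS2 aeN (dyadic_floor_ae_cvg It) => w Nw hw.
  exact: cvg_unique (hXt t It w Nw) hw.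
move: aeN; apply: filterS => w Nw; have [M hM] := goodN w Nw.
apply: (@dyadic_chaining_hoelder _ (fun s => X s w) _ M b b0 hM) => t t01.
by apply: hXt => //; rewrite /I01 /= in_itv.
Qed.

End kolmogorov_chentsov.

(** * Gaussian processes *)

Section gaussian_process.
Context d (T : measurableType d) (R : realType) (P : probability T R).
Variable X : R -> {RV P >-> R}.
Hypothesis gX : centered_gaussian_process P X.

Lemma gaussian_process_rv t : I01 t -> exists v, centered_gaussian_rv P (X t) v.
Proof.
move=> It; have [v hv] := @gX 1%N (fun=> t) (fun=> 1) (fun=> It).
exists v; rewrite (_ : (X t : T -> R) = fun w => \sum_(i < 1) 1 * X t w)//.
by apply/funext => w; rewrite big_ord1 mul1r.
Qed.

Lemma gaussian_process_increment s t : I01 s -> I01 t ->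
  exists v, centered_gaussian_rv P (X s \- X t) v.
Proof.
move=> Is It; pose ts (i : 'I_2) := if i == ord0 then s else t.
pose c (i : 'I_2) : R := if i == ord0 then 1 else - 1.
have Its i : I01 (ts i) by rewrite /ts; case: ifP.
have [v hv] := @gX 2%N ts c Its.
exists v; rewrite (_ : (X s \- X t : T -> R) = fun w => \sum_(i < 2) c i * X (ts i) w)//.
by apply/funext => w; rewrite !big_ord_recl big_ord0 /c /ts /= mul1r mulN1r addr0.
Qed.

(** Square integrability, required by the formulas for variances of sums and differences, is the
    moment bound at m = 0. *)
Lemma gaussian_process_Lfun2 t : I01 t -> (X t : T -> R) \in Lfun P 2%:E.
Proof.
move=> It; have [v gv] := gaussian_process_rv It.
have := centered_gaussian_rv_moment gv 0; rewrite mul1n => h2.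
rewrite inE; apply/andP; split; rewrite inE/=; first exact: measurable_funPT.
rewrite /finite_norm unlock.
apply: poweR_lty; apply: le_lt_trans (ltry _); apply: le_trans h2.
rewrite le_eqVlt; apply/orP; left; apply/eqP; apply: eq_integral => w _.
by rewrite /= powR_mulrn// real_normK// num_real.
Qed.

Lemma gaussian_process_varianceB s t : I01 s -> I01 t ->
  'V_P[(X s \- X t)%R] =
  ('V_P[X s] + 'V_P[X t] - 2%:E * covariance P (X s) (X t))%E.
Proof. by move=> Is It; rewrite varianceB//; exact: gaussian_process_Lfun2. Qed.

(** The 32 is 4 * 8: the moment bound involves [4 * v], and the parameter v of the law is at most 8
    times the variance. *)
Lemma gaussian_process_moment (K al : R) (m : nat) :
  (forall s t, I01 s -> I01 t ->
    ('V_P[(X s \- X t)%R] <= (K * `|s - t| `^ al)%:E)%E) ->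
  forall s t, I01 s -> I01 t ->
  (\int[P]_w (`|X s w - X t w| ^+ (m.+1 * 2))%:E <=
   (Num.sqrt 2 * m.+1`!%:R * (32 * K) ^+ m.+1 * `|s - t| `^ (al * m.+1%:R))%:E)%E.
Proof.
move=> hV s t Is It; have [v gv] := gaussian_process_increment Is It.
have v0 : 0 <= v by have [] := gv.
have hv : (v%:E <= (8 * (K * `|s - t| `^ al))%:E)%E.
  apply: le_trans (centered_gaussian_rv_variance_ge gv) _.
  by rewrite EFinM; apply: lee_wpmul2l; rewrite ?lee_fin//; exact: hV.
rewrite lee_fin in hv.
apply: le_trans (le_trans _ (centered_gaussian_rv_moment gv m)) _.
  rewrite le_eqVlt; apply/orP; left; apply/eqP; apply: eq_integral => w _.
  by rewrite mulnC !exprM real_normK// num_real.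
rewrite lee_fin powRrM powR_mulrn ?powR_ge0// -[leRHS]mulrA -exprMn.
apply: ler_wpM2l; first by rewrite mulr_ge0.
apply: lerXn2r; rewrite ?nnegrE; [lra|lra|].
by move: hv; set z := _ `^ _; lra.
Qed.

End gaussian_process.

(** * Covariance functions of stationary periodic processes *)

Section covariance_function.
Context d (T : measurableType d) (R : realType) (P : probability T R).
Variables (x : R -> {RV P >-> R}) (Ct : R -> R).
Hypothesis xH : in_H P x Ct.

Let I0 : I01 (0 : R). Proof. by rewrite /I01 /= in_itv/= lexx ler01. Qed.

Let gx : centered_gaussian_process P x. Proof. by case: xH. Qed.

Let cov s t : I01 s -> I01 t -> covariance P (x s) (x t) = (Ct (s - t))%:E.
Proof. by case: xH => _ _ + _; apply. Qed.

Lemma in_H_even s t : I01 s -> I01 t -> Ct (s - t) = Ct (t - s).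
Proof.
by move=> Is It; apply: EFin_inj; rewrite -!cov// covarianceC.
Qed.

(** Brings arguments from [-1,1] into [0,1], where the estimates on [Ct] are available. *)
Lemma in_H_norm s t : I01 s -> I01 t -> Ct (s - t) = Ct `|s - t|.
Proof.
move=> Is It; have [st|ts] := leP 0 (s - t); first by rewrite ger0_norm.
by rewrite ltr0_norm// opprB in_H_even.
Qed.

Lemma in_H_varianceB s t : I01 s -> I01 t ->
  'V_P[(x s \- x t)%R] = (2 * (Ct 0 - Ct (s - t)))%:E.
Proof.
move=> Is It; rewrite gaussian_process_varianceB// /variance !cov// !subrr.
by rewrite -EFinM -!EFinD; congr EFin; ring.
Qed.

(** The variances of x_s - x_t and x_s + x_t are nonnegative, which gives the two inequalities. *)
Lemma in_H_normr_le s t : I01 s -> I01 t -> `|Ct (s - t)| <= Ct 0.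
Proof.
move=> Is It; have := variance_ge0 P (x s \- x t).
rewrite in_H_varianceB// lee_fin => h1.
have := variance_ge0 P (x s \+ x t).
rewrite varianceD; [|exact: gaussian_process_Lfun2..].
rewrite /variance !cov// !subrr -EFinM -!EFinD lee_fin => h2.
by rewrite ler_norml; lra.
Qed.

Lemma hoelder_gen_cov (al : R) : 0 < al ->
  hoelder_on I01 Ct al -> hoelder_on2 I01 (gen_cov Ct) al.
Proof.
move=> al0 [K hK].
have I01P (u : R) : I01 u = (0 <= u <= 1) :> Prop by rewrite /I01 /= in_itv.
(* The first term serves Ct (s - t), whose argument moves by at most 2 m; the second serves the
   quotient, by the product rule. The absolute value is there because [K] may be negative. *)
exists (`|K| * 2 `^ al + 2 * `|K|) => s t s' t' Is It Is' It'.
set m := Num.max _ _.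
have ms : `|s - s'| <= m by rewrite le_max lexx.
have mt : `|t - t'| <= m by rewrite le_max lexx orbT.
have m0 : 0 <= m := le_trans (normr_ge0 _) ms.
have hK' (u u' e : R) : I01 u -> I01 u' -> `|u - u'| <= e ->
    `|Ct u - Ct u'| <= `|K| * e `^ al.
  move=> Iu Iu' ue; apply: le_trans (hK u u' Iu Iu') _.
  apply: (@le_trans _ _ (`|K| * `|u - u'| `^ al)).
    by apply: ler_wpM2r; rewrite ?powR_ge0// ler_norm.
  apply: ler_wpM2l => //; apply: ge0_ler_powR; rewrite ?nnegrE//; first exact: ltW.
  exact: le_trans ue.
have Iabs (u u' : R) : I01 u -> I01 u' -> I01 `|u - u'|.
  by rewrite !I01P normr_ge0/= ler_norml => /andP[? ?] /andP[? ?]; lra.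
have h1 : `|Ct (s - t) - Ct (s' - t')| <= `|K| * 2 `^ al * m `^ al.
  rewrite in_H_norm// (in_H_norm Is' It') -mulrA -powRM//.
  apply: hK'; [exact: Iabs|exact: Iabs|].
  apply: le_trans (ler_dist_dist _ _) _.
  have -> : s - t - (s' - t') = (s - s') - (t - t') by ring.
  by apply: le_trans (ler_normB _ _) _; lra.
have hs := hK' _ _ _ Is Is' ms; have ht := hK' _ _ _ It It' mt.
have eN u : I01 u -> Ct (0 - u) = Ct (u - 0) by move=> Iu; exact: in_H_even.
have bd u : I01 u -> `|Ct u| <= Ct 0.
  by move=> Iu; rewrite -{1}(subr0 u); exact: in_H_normr_le.
have h2 : `|Ct (s - 0) * Ct (0 - t) / Ct (0 - 0) -
    Ct (s' - 0) * Ct (0 - t') / Ct (0 - 0)| <= 2 * `|K| * m `^ al.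
  rewrite eN// (eN t')// !subr0 -mulrBl.
  have C0 : 0 <= Ct 0 := le_trans (normr_ge0 _) (bd s Is).
  set z := `|K| * m `^ al in hs ht.
  have z0 : 0 <= z by rewrite mulr_ge0// powR_ge0.
  (* If Ct 0 = 0, both quotients are 0 since the inverse of 0 is 0. *)
  have [->|C0n] := eqVneq (Ct 0) 0.
    by rewrite invr0 mulr0 normr0 -mulrA mulr_ge0.
  have C0p : 0 < Ct 0 by rewrite lt_neqAle eq_sym C0n.
  rewrite normrM normfV (gtr0_norm C0p) ler_pdivrMr// -mulrA -/z.
  (* In each product one factor is bounded by Ct 0, which cancels the denominator. *)
  have -> : Ct s * Ct t - Ct s' * Ct t' = Ct s * (Ct t - Ct t') + Ct t' * (Ct s - Ct s').
    by ring.
  apply: le_trans (ler_normD _ _) _; rewrite !normrM.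
  have -> : 2 * z * Ct 0 = Ct 0 * z + Ct 0 * z by ring.
  by apply: lerD; apply: ler_pM => //; exact: bd.
rewrite /gen_cov.
have -> a b c e : a - b - (c - e) = (a - c) - (b - e) :> R by ring.
apply: le_trans (ler_normB _ _) _; rewrite mulrDl; exact: lerD.
Qed.

Lemma hoelder_gen_cov_variance (al : R) : 0 < al ->
  hoelder_on2 I01 (gen_cov Ct) al ->
  exists K, forall s t, I01 s -> I01 t ->
    ('V_P[(x s \- x t)%R] <= (K * `|s - t| `^ al)%:E)%E.
Proof.
move=> al0 [K hK].
have I01P (u : R) : I01 u = (0 <= u <= 1) :> Prop by rewrite /I01 /= in_itv.
have C0 : 0 <= Ct 0 by have := in_H_normr_le I0 I0; rewrite subrr; apply: le_trans.
(* The variance of x_s - x_t is 2 (Ct 0 - Ct (s - t)), so an estimate of [Ct] at 0 is enough. *)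
suff [K' hK'] : exists K', forall u, I01 u -> Ct 0 - Ct u <= K' * u `^ al.
  exists (2 * K') => s t Is It; rewrite in_H_varianceB// lee_fin -mulrA ler_pM2l//.
  rewrite in_H_norm//; apply: hK'; move: Is It.
  by rewrite !I01P normr_ge0/= ler_norml => /andP[? ?] /andP[? ?]; lra.
have bd u : I01 u -> `|Ct u| <= Ct 0.
  by move=> Iu; rewrite -{1}(subr0 u); exact: in_H_normr_le.
(* Here gen_cov divides by [Ct 0 = 0], but then [Ct] vanishes. *)
have [C00|C0n] := eqVneq (Ct 0) 0.
  exists 0 => u Iu; have := bd u Iu; rewrite C00 normr_le0 => /eqP ->.
  by rewrite subrr mul0r.
have C0p : 0 < Ct 0 by rewrite lt_neqAle eq_sym C0n.
have [dl dl0 hdl] : exists2 dl, 0 < dl & forall u, I01 u -> u < dl -> 0 < Ct u.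
  have [+ _ _ _] := xH; have m11 : -1 < 1 :> R by lra.
  (* 0 is interior to [-1,1], so [Ct] is continuous there in the ordinary sense and positive
     nearby. *)
  move=> /(continuous_within_itvP _ m11)[+ _ _] => /(_ 0).
  rewrite in_itv/= oppr_lt0 !ltr01 => /(_ isT) Cc.
  have [e /= e0 he] := cvgr_gt _ Cc _ C0p.
  exists e => // u; rewrite I01P => /andP[u0 u1] ue; apply: he.
  by rewrite /ball_/= sub0r normrN ger0_norm.
(* [|K|] serves u < dl; for u >= dl the trivial bound 2 Ct 0 is enlarged by the factor (u / dl)^al
   >= 1. *)
exists (`|K| + 2 * Ct 0 / dl `^ al) => u Iu.
have [u0 u1] : 0 <= u /\ u <= 1 by move: (Iu); rewrite I01P => /andP.
have dlp : 0 < dl `^ al by rewrite powR_gt0.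
have [udl|dlu] := ltP u dl.
  have Cu := hdl u Iu udl.
  have := hK u u 0 0 Iu Iu I0 I0; rewrite /gen_cov !subrr !subr0 maxxx (ger0_norm u0).
  rewrite sub0r -[- u]sub0r (in_H_even I0 Iu) subr0 mulfK// subrr subr0 => h.
  have h' : Ct 0 - Ct u * Ct u / Ct 0 <= `|K| * u `^ al.
    apply: le_trans (ler_norm _) _; apply: le_trans h _.
    by apply: ler_wpM2r; rewrite ?powR_ge0// ler_norm.
  (* This is the amount by which R(u,u) = Ct 0 - (Ct u)^2 / Ct 0 exceeds Ct 0 - Ct u. *)
  have h3 : 0 <= (Ct 0 - Ct u) * Ct u / Ct 0.
    rewrite divr_ge0// mulr_ge0// ?subr_ge0; last exact: ltW.
    by apply: le_trans (ler_norm _) _; exact: bd.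
  have h4 : 0 <= 2 * Ct 0 / dl `^ al * u `^ al.
    by rewrite mulr_ge0 ?powR_ge0// divr_ge0 ?mulr_ge0// ltW.
  have h5 : (Ct 0 - Ct u) * Ct u / Ct 0 = Ct u - Ct u * Ct u / Ct 0 by field.
  by rewrite mulrDl; lra.
have h6 : dl `^ al <= u `^ al by apply: ge0_ler_powR; rewrite ?nnegrE// ltW.
have h7 : 2 * Ct 0 <= 2 * Ct 0 / dl `^ al * u `^ al.
  by rewrite mulrAC ler_pdivlMr// ler_wpM2l// mulr_ge0.
have h8 : 0 <= `|K| * u `^ al by rewrite mulr_ge0// powR_ge0.
have := bd u Iu; rewrite ler_norml mulrDl => /andP[? ?]; lra.
Qed.

End covariance_function.

(** * Hölder modifications of Gaussian processes *)

Lemma gaussian_process_hoelder_modification d (T : measurableType d)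
  (R : realType) (P : probability T R) (X : R -> {RV P >-> R}) (K al b : R) :
  centered_gaussian_process P X ->
  (forall s t, I01 s -> I01 t ->
    ('V_P[(X s \- X t)%R] <= (K * `|s - t| `^ al)%:E)%E) ->
  0 < b < al / 2 ->
  exists Xt : R -> {RV P >-> R}, modification P X Xt /\ ae_hoelder_paths P Xt b.
Proof.
move=> gX hV /andP[b0 bal].
have g0 : 0 < al - 2 * b by lra.
(* Then (m + 1) (al - 2 b) > 1, which is the exponent condition 1 + p b < a for p = 2 (m + 1) and a
   = al (m + 1). *)
pose m := Num.truncn (al - 2 * b)^-1.
have hm : 1 < (al - 2 * b) * m.+1%:R.
  by rewrite -ltr_pdivrMl// mulr1 truncnS_gt.
apply: (@kolmogorov_chentsov _ _ _ P X (m.+1 * 2) _ (al * m.+1%:R) b _ b0 _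
  (gaussian_process_moment gX m hV)) => //.
by rewrite natrM; move: hm; set z := m.+1%:R; lra.
Qed.

Unset Implicit Arguments.

Theorem theorem5p3 (R : realType)
  (d : measure_display) (T : measurableType d) (P : probability T R)
  (x : R -> {RV P >-> R}) (Ct : R -> R)
  (d' : measure_display) (T' : measurableType d') (P' : probability T' R)
  (y : R -> {RV P' >-> R}) (alpha : R) :
  in_H P x Ct -> generated_by P' y Ct -> 0 < alpha <= 1 ->
  (hoelder_on I01 Ct alpha -> hoelder_on2 I01 (gen_cov Ct) alpha) /\
  (hoelder_on2 I01 (gen_cov Ct) alpha ->
     forall beta : R, 0 < beta < alpha / 2 ->
       (exists yt : R -> {RV P' >-> R},
           modification P' y yt /\ ae_hoelder_paths P' yt beta) /\
       (exists xt : R -> {RV P >-> R},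
           modification P x xt /\ ae_hoelder_paths P xt beta)).
Proof.
move=> xH [gy covy] /andP[al0 _]; split; first exact: hoelder_gen_cov xH _ al0.
move=> hR beta hbeta; split; last first.
  have [K hK] := hoelder_gen_cov_variance xH al0 hR.
  by apply: gaussian_process_hoelder_modification hK hbeta; case: xH.
have [K hK] := hR.
(* The variance of y_s - y_t is (R(s,s) - R(s,t)) + (R(t,t) - R(s,t)), and each bracket is at most K
   |s - t|^alpha. *)
apply: (@gaussian_process_hoelder_modification _ _ _ _ _ (2 * K) alpha) => //.
move=> s t Is It; rewrite gaussian_process_varianceB// /variance !covy//.
rewrite -EFinM -!EFinD lee_fin.
have h1 := hK s s s t Is Is Is It; have h2 := hK t t s t It It Is It.
move: h1 h2; rewrite !subrr normr0 (distrC t s) (max_r (normr_ge0 _)).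
rewrite (max_l (normr_ge0 _)) !ler_norml => /andP[_ h1] /andP[_ h2]; lra.
Qed.
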